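(* Suppose that $w$ is a weight on $T$. The following are equivalent: (i) $w\in A_\infty(\mu)$; (ii) $[w]_{A_\infty(\mu)}<\infty$; (iii) there is $\gamma_0\in(0,1)$ such that for all $\gamma\in(0,\gamma_0)$ there exists $\delta=\delta(\gamma)\in(0,1)$ such that for all $R\in\mathcal R$ $$\mu\Big(\Big\{x\in R: w(x)\le\frac{\gamma}{\mu(R)}\sum_{y\in R}w(y)\mu(y)\Big\}\Big)\le\delta\,\mu(R);$$ furthermore, for every $\varepsilon>0$ we can choose $\gamma\in(0,\gamma_0)$ such that $\delta(\gamma)<\varepsilon$; (iv) for every $\xi\in(0,1)$ there is $\eta=\eta(\xi)\in(0,1)$ such that for all $R\in\mathcal R$ and $S\subset R$ $$\mu(S)\le\xi\,\mu(R)\ \Longrightarrow\ w_\mu(S)\le\eta\,w_\mu(R).$$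
   Context: Tree and flow measure. $T$ is (the vertex set of) an infinite tree, i.e. an infinite connected graph with no loops. $d$ is the geodesic distance and $x\sim y$ means $d(x,y)=1$. $\partial T$ is the boundary of $T$ (equivalence classes of semi-infinite geodesics, two being equivalent if they eventually coincide). Fix $\omega_*\in\partial T$; $[x,\omega_* )$ is the semi-infinite geodesic from $x$ to $\omega_*$, and $x\le y$ means $y\in[x,\omega_* )$. Fix $o\in T$, enumerate $[o,\omega_* )=\{x_j\}_{j\in\mathbb N}$ with $x_0=o$ and $d(x_j,x_k)=|j-k|$, and define the level $\ell(x)=\lim_{j\to\infty}(j-d(x,x_j))$. The set of successors of $x$ is $s(x)=\{y\sim x:\ell(y)=\ell(x)-1\}$. A flow measure is a positive function $\mu$ on $T$ with $\mu(x)=\sum_{y\in s(x)}\mu(y)$ for all $x\in T$; $\mu(E)=\sum_{y\in E}\mu(y)$. Standing assumption: $\mu$ is a flow measure which is locally doubling on $(T,d)$, i.e. for every $r>0$ there is $D_r$ with $\mu(B(x,2r))\le D_r\,\mu(B(x,r))$ for all $x\in T$ (this implies that $T$ has uniformly bounded degree). A weight is a positive function on $T$. Trapezoids. Fix a number $\beta\ge 12$. For $x\in T$ and $h_1,h_2\in\mathbb N$, $h_1<h_2$, the trapezoid with root $x$ and heights $h_1,h_2$ is $R_{h_1}^{h_2}(x)=\{y\in T: y\le x,\ h_1\le d(x,y)<h_2\}$. It is admissible if $2\le h_2/h_1\le\beta$ (so $h_1\ge1$). $\mathcal R$ is the family of all admissible trapezoids and all singletons. Weights. For a weight $w$ and $E\subset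 T$, $w_\mu(E)=\sum_{y\in E}w(y)\mu(y)$. For $p\in(1,\infty)$, $w\in A_p(\mu)$ means $$\sup_{R\in\mathcal R}\Big(\frac1{\mu(R)}\sum_{y\in R}w(y)\mu(y)\Big)\Big(\frac1{\mu(R)}\sum_{y\in R}w(y)^{-1/(p-1)}\mu(y)\Big)^{p-1}<\infty.$$ $A_\infty(\mu)=\bigcup_{p>1}A_p(\mu)$, and $$[w]_{A_\infty(\mu)}=\sup_{R\in\mathcal R}\Big(\frac1{\mu(R)}\sum_{y\in R}w(y)\mu(y)\Big)\exp\Big[\frac1{\mu(R)}\sum_{y\in R}\log(w(y)^{-1})\mu(y)\Big].$$ *)

(* Defs.v *)
From HB Require Import structures.
From mathcomp Require Import all_boot all_order all_algebra.
From mathcomp Require Import all_classical all_reals all_analysis.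

Set Implicit Arguments.
Unset Strict Implicit.
Unset Printing Implicit Defensive.

Import Order.TTheory GRing.Theory Num.Theory.
Import numFieldNormedType.Exports.

Local Open Scope classical_set_scope.
Local Open Scope ring_scope.

(* In a simple graph the duplicate-free cycles of size at most 2 are the
   degenerate ones [::] and [:: x; y]; all others are genuine cycles. *)
Definition is_tree (T : choiceType) (e : rel T) : Prop :=
  [/\ symmetric e, irreflexive e,
      forall x y, exists2 p : seq T, path e x p & last x p = y
    & forall c : seq T, ucycle e c -> (size c <= 2)%N].

Definition walk_length (T : choiceType) (e : rel T) (x y : T) : set nat :=
  [set n | exists p : seq T, [/\ path e x p, last x p = y & size p = n]].

(* The least element of [walk_length e x y], which is nonempty when the graph
   is connected. *)
Definition tdist (T : choiceType) (e : rel T) (x y : T) : nat :=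
  xget 0%N [set n | walk_length e x y n /\
                    forall m, walk_length e x y m -> (n <= m)%N].

Definition tball (R : realType) (T : choiceType) (e : rel T) (x : T) (r : R) :
  set T := [set y | (tdist e x y)%:R <= r].

Definition geodesic_ray (T : choiceType) (e : rel T) (g : nat -> T) : Prop :=
  forall i j : nat, (i <= j)%N -> tdist e (g i) (g j) = (j - i)%N.

(* The two rays may have different starting points, hence the two offsets. *)
Definition eventually_coincide (T : choiceType) (g h : nat -> T) : Prop :=
  exists m n : nat, forall k : nat, g (m + k)%N = h (n + k)%N.

Definition boundary (T : choiceType) (e : rel T) : set (set (nat -> T)) :=
  [set omega | exists2 g, geodesic_ray e g &
    omega = [set h | geodesic_ray e h /\ eventually_coincide g h]].

(* The geodesic [x, omega), as a sequence starting at x: the unique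
   representative of omega with first vertex x. *)
Definition ray (T : choiceType) (omega : set (nat -> T)) (x : T) : nat -> T :=
  xget (fun=> x) [set g | omega g /\ g 0%N = x].

(* The order x <= y, that is, y belongs to [x, omega). *)
Definition below (T : choiceType) (omega : set (nat -> T)) (x y : T) : Prop :=
  exists n : nat, ray omega x n = y.

Definition level (R : realType) (T : choiceType) (e : rel T)
    (omega : set (nat -> T)) (o x : T) : R :=
  limn (fun j : nat => j%:R - (tdist e x (ray omega o j))%:R : R).

Definition successors (R : realType) (T : choiceType) (e : rel T)
    (omega : set (nat -> T)) (o x : T) : set T :=
  [set y | e x y /\ level R e omega o y = level R e omega o x - 1].

(* Local finiteness is not assumed but follows from local doubling, so sums
   over successors and balls are taken in the extended reals. *)
Definition flow_measure (R : realType) (T : choiceType) (e : rel T)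
    (omega : set (nat -> T)) (o : T) (mu : T -> R) : Prop :=
  (forall x, 0 < mu x) /\
  forall x, (mu x)%:E = \esum_(y in successors R e omega o x) (mu y)%:E.

Definition locally_doubling (R : realType) (T : choiceType) (e : rel T)
    (mu : T -> R) : Prop :=
  forall r : R, 0 < r -> exists D : R, forall x : T,
    (\esum_(y in tball e x (2 * r)) (mu y)%:E <=
     D%:E * \esum_(y in tball e x r) (mu y)%:E)%E.

Definition trapezoid (T : choiceType) (e : rel T) (omega : set (nat -> T))
    (x : T) (h1 h2 : nat) : set T :=
  [set y | below omega y x /\ (h1 <= tdist e x y < h2)%N].

Definition admissible (R : realType) (beta : R) (h1 h2 : nat) : Prop :=
  [/\ (0 < h1)%N, (h1 < h2)%N & 2 <= (h2%:R / h1%:R : R) <= beta].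

(* The family of all admissible trapezoids and all singletons. *)
Definition trapezoids (R : realType) (T : choiceType) (e : rel T)
    (omega : set (nat -> T)) (beta : R) : set (set T) :=
  [set A | (exists x, A = [set x]) \/
           exists x h1 h2, admissible beta h1 h2 /\
                           A = trapezoid e omega x h1 h2].

(* [mass], [wmass] and [avg] are applied only to members of [trapezoids] and
   their subsets, which are finite for a locally doubling flow measure (the
   finitely supported sum below is 0 if the support in A is infinite). *)
Definition mass (R : realType) (T : choiceType) (mu : T -> R) (A : set T) : R :=
  \sum_(y \in A) mu y.

Definition wmass (R : realType) (T : choiceType) (mu w : T -> R) (A : set T) :
  R := \sum_(y \in A) w y * mu y.

Definition avg (R : realType) (T : choiceType) (mu f : T -> R) (A : set T) : R :=
  (mass mu A)^-1 * \sum_(y \in A) f y * mu y.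

Definition Ap (R : realType) (T : choiceType) (e : rel T)
    (omega : set (nat -> T)) (beta : R) (mu : T -> R) (p : R) (w : T -> R) :
  Prop :=
  (ereal_sup [set (avg mu w A *
      avg mu (fun y => w y `^ (- (p - 1)^-1)) A `^ (p - 1))%:E
      | A in trapezoids e omega beta] < +oo)%E.

Definition Ainfty (R : realType) (T : choiceType) (e : rel T)
    (omega : set (nat -> T)) (beta : R) (mu : T -> R) (w : T -> R) : Prop :=
  exists p : R, 1 < p /\ Ap e omega beta mu p w.

Definition Ainfty_const (R : realType) (T : choiceType) (e : rel T)
    (omega : set (nat -> T)) (beta : R) (mu : T -> R) (w : T -> R) : \bar R :=
  ereal_sup [set (avg mu w A * expR (avg mu (fun y => ln (w y)^-1) A))%:E
      | A in trapezoids e omega beta].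

(* Main.v *)
Require Import Defs.
From HB Require Import structures.
From mathcomp Require Import all_boot all_order all_algebra.
From mathcomp Require Import all_classical all_reals all_analysis.
From mathcomp Require Import finmap zify ring lra.

Set Implicit Arguments.
Unset Strict Implicit.
Unset Printing Implicit Defensive.

Import Order.TTheory GRing.Theory Num.Theory.
Import numFieldNormedType.Exports.

Local Open Scope classical_set_scope.
Local Open Scope ring_scope.

(** Only the last implication, from (iv) to membership in some A_p, depends on
    the geometry; the other three hold for any family of nonempty finite sets.

    From (i) to (ii): Jensen's inequality for the logarithm, applied to the
    power [w `^ (- (p - 1)^-1)], bounds the exponential factor of the
    A_infinity functional by the second factor of the A_p functional.

    From (ii) to (iii): with W the average of w on A, the function
    ln (W / w) - 1 + w / W is nonnegative, has average at most the logarithm L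
    of the A_infinity constant, and is at least ln (1 / gamma) - 1 where
    w <= gamma W.  Markov's inequality gives
    delta (gamma) = L / (ln (1 / gamma) - 1).

    From (iii) to (iv): if S carried nearly all of the w-mass of A, then w would
    be small on most of A minus S, a set of mu-mass at least (1 - xi) mu(A).

    From (iv) to (i): one proves a reverse Hoelder inequality for 1 / w with
    respect to the measure with density w mu, that is, a bound of the sum of
    w^(-eps) mu over A by a multiple of (mu(A) / w_mu(A))^eps mu(A); this is
    the A_p condition with p = 1 + 1 / eps.  The stopping time argument needs
    each admissible trapezoid to be a disjoint union of admissible trapezoids
    or singletons of comparable mu-mass, down to singletons:
    - if h2 >= 4 h1, cut horizontally at height 2 h1;
    - if h2 < 4 h1 and h1 >= 2, cut vertically into the trapezoids with heights
      h1 - 1 and h2 - 1 rooted at the successors of the root;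
    - if h1 = 1 and h2 is 2 or 3, cut into singletons.
    The flow property gives the trapezoid with root x the mass
    (h2 - h1) mu(x), and doubling makes the mass of a successor comparable to
    that of its predecessor, so the pieces are comparable
    ([splitting_trapezoids]).
    Condition (iv) with xi close to 1 transfers comparability to w_mu, which
    gives a Calderon-Zygmund decomposition ([calderon_zygmund]); condition (iv)
    with xi = 1 / 2 says that the selected set has at most half of the mass,
    so that the induction in [reverse_holder] closes.

    The geometry is reduced to one map: sending x to the next vertex of
    [x, omega).  Simple paths in a tree being unique, every vertex starts
    exactly one ray of omega, trapezoids are unions of fibres of iterates of
    this map ([trapezoidE]), and successors are its preimages
    ([successorsE]). *)

(** * Sums over finite sets *)

Lemma ler_fsum (R : realType) (T : choiceType) (A : set T) (f g : T -> R) :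
  finite_set A -> (forall x, A x -> f x <= g x) ->
  \sum_(x \in A) f x <= \sum_(x \in A) g x.
Proof.
move=> finA fg; rewrite !fsbig_finite//= big_seq [leRHS]big_seq.
by apply: ler_sum => x; rewrite in_fset_set// => /set_mem/fg.
Qed.

Lemma fsum_bigcup (R : realType) (T I : choiceType) (J : set I)
    (P : I -> set T) (f : T -> R) :
  finite_set J -> (forall i, J i -> finite_set (P i)) -> trivIset J P ->
  \sum_(x \in \bigcup_(i in J) P i) f x =
  \sum_(i \in J) \sum_(x \in P i) f x.
Proof.
move=> /finite_seqP[s0 ->].
have -> : [set` s0] = [set` undup s0].
  by apply/seteqP; split=> x /=; rewrite mem_undup.
elim: (undup s0) (undup_uniq s0) => {s0} [_ _ _|i s IH].
  rewrite (_ : [set` [::]] = set0); last by apply/seteqP; split.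
  by rewrite bigcup_set0 !fsbig_set0.
move=> /andP[nis us].
have consE : [set` i :: s] = i |` [set` s].
  apply/seteqP; split=> j /=; rewrite in_cons; last first.
    by case=> [->|->]; rewrite ?eqxx// orbT.
  by case/orP => [/eqP->|]; [left|right].
rewrite consE => finP trivP.
have finPs j : [set` s] j -> finite_set (P j).
  by move=> sj; apply: finP; right.
have trivPs : trivIset [set` s] P.
  by move=> j k sj sk; apply: trivP; right.
rewrite bigcup_setU1 [RHS]fsbigU0//; last first.
  by move=> j /= [-> sj]; rewrite sj in nis.
rewrite fsbig_set1 -IH// fsbigU0//.
- by apply: finP; left.
- exact: bigcup_finite.
- move=> x [Px [j sj Pjx]]; move: (nis).
  by rewrite (trivP i j) ?sj//; [left|right|exists x].
Qed.

Lemma mass_gt0 (R : realType) (T : choiceType) (mu : T -> R) (A : set T) :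
  (forall x, 0 < mu x) -> finite_set A -> A !=set0 -> 0 < mass mu A.
Proof.
move=> mu0 finA [x Ax]; rewrite /mass (fsbigD1 x)//=.
by apply: ltr_pwDl => //; apply: fsumr_ge0 => y _; exact: ltW.
Qed.

Lemma massU (R : realType) (T : choiceType) (mu : T -> R) (A U : set T) :
  finite_set A -> U `<=` A -> mass mu A = mass mu U + mass mu (A `\` U).
Proof. by move=> finA UA; rewrite /mass (fsbigID U)//= (setIidr UA). Qed.

Lemma ler_mass (R : realType) (T : choiceType) (mu : T -> R) (A U : set T) :
  (forall x, 0 < mu x) -> finite_set A -> U `<=` A -> mass mu U <= mass mu A.
Proof.
move=> mu0 finA UA; rewrite (massU mu finA UA) lerDl.
by apply: fsumr_ge0 => x _; exact: ltW.
Qed.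

Lemma wmassE (R : realType) (T : choiceType) (mu w : T -> R) (A : set T) :
  wmass mu w A = mass (fun x => w x * mu x) A.
Proof. by []. Qed.

Lemma avgE (R : realType) (T : choiceType) (mu f : T -> R) (A : set T) :
  avg mu f A = wmass mu f A / mass mu A.
Proof. by rewrite /avg mulrC. Qed.

Lemma wmass_affine (R : realType) (T : choiceType) (mu f : T -> R) (a b : R)
    (A : set T) : finite_set A ->
  wmass mu (fun x => a * f x + b) A = a * wmass mu f A + b * mass mu A.
Proof.
move=> finA; rewrite /wmass /mass !mulr_fsumr -fsbig_split//=.
by apply: eq_fsbigr => x _; rewrite mulrDl mulrA.
Qed.

Lemma ler_wmass (R : realType) (T : choiceType) (mu f g : T -> R) (A : set T) :
  (forall x, 0 < mu x) -> finite_set A -> (forall x, A x -> f x <= g x) ->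
  wmass mu f A <= wmass mu g A.
Proof.
move=> mu0 finA fg; apply: ler_fsum => // x /fg.
by rewrite ler_pM2r.
Qed.

Lemma wmass_gt0 (R : realType) (T : choiceType) (mu w : T -> R) (A : set T) :
  (forall x, 0 < mu x) -> (forall x, 0 < w x) -> finite_set A -> A !=set0 ->
  0 < wmass mu w A.
Proof.
by move=> mu0 w0 finA A0; apply: mass_gt0 => // x; exact: mulr_gt0.
Qed.

(** * From A_p to the small values of w *)

Lemma ereal_sup_image_lty (R : realType) (S : Type) (D : set S) (F : S -> R) :
  (ereal_sup [set (F A)%:E | A in D] < +oo)%E <->
  exists C, forall A, D A -> F A <= C.
Proof.
split=> [supD|[C FC]]; last first.
  apply: (@le_lt_trans _ _ C%:E); last exact: ltry.
  by apply: ge_ereal_sup => _ [A DA <-]; rewrite lee_fin FC.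
exists (fine (ereal_sup [set (F A)%:E | A in D])) => A DA.
have FA : ((F A)%:E <= ereal_sup [set (F A)%:E | A in D])%E.
  by apply: ereal_sup_ubound; exists A.
rewrite -lee_fin fineK// fin_numE -ltey supD andbT.
by apply/eqP => supN; move: FA; rewrite supN leeNy_eq.
Qed.

Lemma ln_le_sub1 (R : realType) (x : R) : 0 < x -> ln x <= x - 1.
Proof. by move=> x0; rewrite -{1}(subrKC 1 x) le_ln1Dx//; lra. Qed.

(** Jensen's inequality: average the tangent line bound
    ln (f / W) <= f / W - 1, where W is the average of f. *)
Lemma avg_ln_le (R : realType) (T : choiceType) (mu f : T -> R) (A : set T) :
  (forall x, 0 < mu x) -> (forall x, 0 < f x) -> finite_set A -> A !=set0 ->
  avg mu (fun x => ln (f x)) A <= ln (avg mu f A).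
Proof.
move=> mu0 f0 finA A0.
have mA := mass_gt0 mu0 finA A0; have fA := wmass_gt0 mu0 f0 finA A0.
have W0 : 0 < avg mu f A by rewrite avgE divr_gt0.
set W := avg mu f A in W0 *.
have H : wmass mu (fun x => ln (f x)) A <=
         wmass mu (fun x => W^-1 * f x + (ln W - 1)) A.
  apply: ler_wmass => // x _.
  have := @ln_le_sub1 _ (W^-1 * f x) (mulr_gt0 _ (f0 x)).
  by rewrite invr_gt0 lnM ?posrE ?invr_gt0// lnV ?posrE// => /(_ W0); lra.
rewrite avgE ler_pdivrMr//; apply: le_trans H _; rewrite wmass_affine//.
rewrite /W avgE invf_div mulfVK ?gt_eqF//; lra.
Qed.

Lemma Ainfty_const_of_Ap (R : realType) (T : choiceType) (mu w : T -> R)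
    (F : set (set T)) (p C : R) :
  (forall x, 0 < mu x) -> (forall x, 0 < w x) -> 1 < p ->
  (forall A, F A -> finite_set A /\ A !=set0) ->
  (forall A, F A -> avg mu w A *
     avg mu (fun y => w y `^ (- (p - 1)^-1)) A `^ (p - 1) <= C) ->
  forall A, F A -> avg mu w A * expR (avg mu (fun y => ln (w y)^-1) A) <= C.
Proof.
move=> mu0 w0 p1 Ffin ApC A FA; apply: le_trans (ApC A FA).
have [finA A0] := Ffin A FA.
have mA := mass_gt0 mu0 finA A0.
rewrite ler_pM2l; last by rewrite avgE divr_gt0// wmass_gt0.
set v := fun y => w y `^ (- (p - 1)^-1).
have v0 x : 0 < v x by exact: powR_gt0.
have vA : 0 < avg mu v A by rewrite avgE divr_gt0// wmass_gt0.
have -> : avg mu (fun y => ln (w y)^-1) A =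
          (p - 1) * avg mu (fun y => ln (v y)) A.
  rewrite !avgE mulrA -[(p - 1) * _]addr0 -[X in _ + X](mul0r (mass mu A)).
  rewrite -wmass_affine//; congr (_ / _); apply: eq_fsbigr => x _.
  congr (_ * _); rewrite ln_powR lnV ?posrE// addr0 mulNr mulrN mulrA divff.
    by rewrite mul1r.
  by rewrite subr_eq0 gt_eqF.
rewrite -ler_ln ?posrE ?expR_gt0 ?powR_gt0// expRK ln_powR ler_pM2l ?subr_gt0//.
exact: avg_ln_le.
Qed.

(** Markov's inequality for the nonnegative function
    ln (W / w) - 1 + w / W, whose average is that of ln (W / w) because w / W
    averages to 1; the A_infinity constant bounds this average by L. *)
Lemma small_values_of_Ainfty_const (R : realType) (T : choiceType)
    (mu w : T -> R) (F : set (set T)) (L : R) :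
  (forall x, 0 < mu x) -> (forall x, 0 < w x) ->
  (forall A, F A -> finite_set A /\ A !=set0) ->
  (forall A, F A ->
     avg mu w A * expR (avg mu (fun y => ln (w y)^-1) A) <= expR L) ->
  forall gamma : R, 0 < gamma -> 1 < - ln gamma -> forall A, F A ->
    mass mu [set x | A x /\ w x <= gamma / mass mu A * wmass mu w A] <=
    L / (- ln gamma - 1) * mass mu A.
Proof.
move=> mu0 w0 Ffin FL gamma g0 g1 A FA.
have [finA A0] := Ffin A FA.
have mA := mass_gt0 mu0 finA A0; have wA := wmass_gt0 mu0 w0 finA A0.
set S := [set x | _]; have SA : S `<=` A by move=> x [].
have [W WavgE] : {W | avg mu w A = W} by exists (avg mu w A).
have WE : W = wmass mu w A / mass mu A by rewrite -WavgE avgE.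
have W0 : 0 < W by rewrite WE divr_gt0.
pose g x := (ln (w x)^-1 + (ln W - 1)) + W^-1 * w x.
have g_ge0 x : 0 <= g x.
  have := @ln_le_sub1 _ (W^-1 * w x) (mulr_gt0 _ (w0 x)).
  rewrite invr_gt0 lnM ?posrE ?invr_gt0// lnV ?posrE// => /(_ W0).
  by rewrite /g lnV ?posrE//; lra.
have gS x : S x -> - ln gamma - 1 <= g x.
  case=> Ax wx; have : ln (w x) <= ln gamma + ln W.
    have gW0 : 0 < gamma * W by exact: mulr_gt0.
    by rewrite -lnM ?posrE// ler_ln ?posrE// WE (mulrC (wmass _ _ _)) mulrA.
  have : 0 < W^-1 * w x by rewrite mulr_gt0 ?invr_gt0.
  by rewrite /g lnV ?posrE//; lra.
have avgL : avg mu (fun y => ln (w y)^-1) A + ln W <= L.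
  have := FL A FA; rewrite WavgE -ler_ln ?posrE ?mulr_gt0 ?expR_gt0//.
  by rewrite lnM ?posrE ?expR_gt0// !expRK addrC.
have intg : wmass mu g A <= L * mass mu A.
  have -> : wmass mu g A = avg mu (fun y => ln (w y)^-1) A * mass mu A +
                           (ln W - 1) * mass mu A + mass mu A.
    rewrite /wmass /g.
    under eq_fsbigr do rewrite mulrDl -[in X in X + _](mul1r (ln _)).
    rewrite fsbig_split//= -/(wmass mu (fun x => 1 * _ + (ln W - 1)) A).
    rewrite wmass_affine// mul1r avgE mulfVK ?gt_eqF//; congr (_ + _).
    under eq_fsbigr do rewrite -mulrA.
    rewrite -mulr_fsumr -/(wmass mu w A) WE invf_div.
    by rewrite mulfVK ?gt_eqF.
  rewrite -[X in _ + X]mul1r -!mulrDl ler_pM2r//; lra.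
rewrite mulrAC ler_pdivlMr ?subr_gt0//; apply: le_trans intg.
rewrite [leRHS](@massU _ _ (fun x => g x * mu x) A S)//.
rewrite -[leLHS]addr0 lerD//; last first.
  by apply: fsumr_ge0 => x _; rewrite mulr_ge0// ltW.
rewrite mulrC mulr_fsumr; apply: ler_fsum.
  exact: sub_finite_set finA.
by move=> x Sx; rewrite ler_pM2r// gS.
Qed.

(** Off the set where w is small, A minus S has w-mass at least gamma times
    the average of w times its mu-mass.  If its w-mass is below a fraction
    1 - eta of the total, this part has mu-mass below a fraction
    (1 - eta) / gamma, and adding the fraction delta where w is small still
    leaves less than the fraction 1 - xi that A minus S must have. *)
Lemma wmass_le_of_small_values (R : realType) (T : choiceType)
    (mu w : T -> R) (A S : set T) (gamma delta xi eta : R) :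
  (forall x, 0 < mu x) -> (forall x, 0 < w x) ->
  finite_set A -> A !=set0 -> 0 < gamma ->
  delta + (1 - eta) / gamma <= 1 - xi ->
  mass mu [set x | A x /\ w x <= gamma / mass mu A * wmass mu w A] <=
    delta * mass mu A ->
  S `<=` A -> mass mu S <= xi * mass mu A ->
  wmass mu w S <= eta * wmass mu w A.
Proof.
move=> mu0 w0 finA A0 g0 dxe small SA muS.
have mA := mass_gt0 mu0 finA A0; have wA := wmass_gt0 mu0 w0 finA A0.
rewrite leNgt; apply/negP => wS.
set E := [set x | _] in small; have EA : E `<=` A by move=> x [].
have finAS : finite_set (A `\` S) by exact: finite_setD.
have := massU mu finA SA; have := massU (fun x => w x * mu x) finA SA.
rewrite -!wmassE => wAS muAS.
have AE : mass mu ((A `\` S) `\` E) * (gamma * wmass mu w A / mass mu A) <=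
    wmass mu w (A `\` S).
  rewrite mulrC mulr_fsumr.
  apply: (@le_trans _ _ (wmass mu w ((A `\` S) `\` E))).
    apply: ler_fsum; first exact: finite_setD.
    move=> x [[Ax _] /not_andP[//|/negP]]; rewrite -ltNge => wx.
    by rewrite ler_pM2r//; apply: ltW; apply: le_lt_trans wx; rewrite mulrAC.
  apply: (@ler_mass _ _ (fun x => w x * mu x)) => //.
  by move=> x; rewrite mulr_gt0.
have : mass mu (A `\` S) <= delta * mass mu A + mass mu ((A `\` S) `\` E).
  rewrite (@massU _ _ mu (A `\` S) ((A `\` S) `&` E))//.
  rewrite setDIr setDv set0U lerD2r; apply: le_trans small.
  by apply: ler_mass => //; exact: sub_finite_set finA.
have : mass mu ((A `\` S) `\` E) < (1 - eta) / gamma * mass mu A.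
  rewrite -(@ltr_pM2r _ (gamma * wmass mu w A / mass mu A)); last first.
    by rewrite divr_gt0// mulr_gt0.
  apply: le_lt_trans AE _.
  suff -> : (1 - eta) / gamma * mass mu A * (gamma * wmass mu w A / mass mu A) =
     (1 - eta) * wmass mu w A by lra.
  by field; rewrite !gt_eqF.
have := ler_pM2r mA (delta + (1 - eta) / gamma) (1 - xi); rewrite dxe.
rewrite mulrDl; lra.
Qed.

(** * The reverse Hoelder inequality *)

(** The pieces [P i] are members of the family of smaller rank, which is what
    inductions over the decomposition use. *)
Definition splitting (R : realType) (T : choiceType) (mu : T -> R) (c : R)
    (D : nat -> set (set T)) : Prop :=
  forall n A, D n A -> (exists x, A = [set x]) \/
    exists (I : choiceType) (J : set I) (P : I -> set T),
      [/\ finite_set J, trivIset J P, A = \bigcup_(i in J) P i &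
        forall i, J i -> c * mass mu A <= mass mu (P i) /\
          exists2 m, (m < n)%N & D m (P i)].

(** The set U is the union of the maximal pieces on which the average of
    1 / w with respect to w mu exceeds lam.  The parent of such a piece has
    average at most lam, so the piece itself has average at most lam / c';
    this is why the bound on g is only required below that level.  Stating
    the three conclusions for U, which add up over disjoint pieces, avoids
    keeping the collection of selected pieces. *)
Lemma calderon_zygmund (R : realType) (T : choiceType) (mu w g : T -> R)
    (c c' lam K : R) (D : nat -> set (set T)) (n : nat) :
  (forall x, 0 < mu x) -> (forall x, 0 < w x) -> 0 < lam -> 0 < c' ->
  splitting mu c D -> (forall m A, D m A -> finite_set A) ->
  (forall m A k P, D m A -> D k P -> P `<=` A ->
     c * mass mu A <= mass mu P -> c' * wmass mu w A <= wmass mu w P) ->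
  (forall m A, (m < n)%N -> D m A -> c' * mass mu A <= lam * wmass mu w A ->
     wmass mu g A <= K * mass mu A) ->
  forall A, D n A -> mass mu A <= lam * wmass mu w A ->
  exists U, [/\ U `<=` A, forall x, (A `\` U) x -> 1 <= lam * w x,
    lam * wmass mu w U <= mass mu U & wmass mu g U <= K * mass mu U].
Proof.
move=> mu0 w0 lam0 c'0 splitD finD doubD gD.
elim/ltn_ind: n gD => n IH gD A DA muA.
have [[x Ax]|[I [J [P [finJ trivP AE PJ]]]]] := splitD n A DA.
  exists set0; rewrite /mass /wmass !fsbig_set0 !mulr0; split=> //.
  move=> y [+ _]; rewrite Ax => ->; move: muA.
  by rewrite Ax /mass /wmass !fsbig_set1 -[leLHS]mul1r mulrA ler_pM2r.
have PA i : J i -> P i `<=` A by move=> Ji; rewrite AE; exact: bigcup_sup.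
have /choice[U HU] i : exists U, J i -> [/\ U `<=` P i,
    forall x, (P i `\` U) x -> 1 <= lam * w x,
    lam * wmass mu w U <= mass mu U & wmass mu g U <= K * mass mu U].
  have [Ji|nJi] := pselect (J i); last by exists set0.
  have [cP [m mn DP]] := PJ i Ji.
  have [Plam|Plam] := leP (mass mu (P i)) (lam * wmass mu w (P i)).
    have [|U HU] := IH m mn _ (P i) DP Plam; last by exists U.
    by move=> k B km; apply: gD; exact: ltn_trans mn.
  exists (P i) => _; split=> //; first by move=> x; rewrite setDv.
    exact: ltW.
  apply: (gD _ _ mn DP).
  have PlA : mass mu (P i) <= lam * wmass mu w A.
    apply: le_trans muA; apply: ler_mass => //; last exact: PA.
    exact: finD DA.
  apply: (@le_trans _ _ (c' * (lam * wmass mu w A))); first by rewrite ler_pM2l.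
  by rewrite mulrCA ler_pM2l//; exact: (doubD _ _ _ _ DA DP (PA i Ji)).
have finU i : J i -> finite_set (U i).
  move=> Ji; have [UP _ _ _] := HU i Ji; have [_ [m _ DP]] := PJ i Ji.
  exact: sub_finite_set (finD _ _ DP).
have trivU : trivIset J U.
  move=> i j Ji Jj [x [Uix Ujx]]; apply: trivP => //; exists x; split.
    by have [UP _ _ _] := HU i Ji; exact: UP.
  by have [UP _ _ _] := HU j Jj; exact: UP.
exists (\bigcup_(i in J) U i); split.
- move=> x [i Ji Ux]; apply: (PA i Ji).
  by have [UP _ _ _] := HU i Ji; exact: UP.
- move=> x []; rewrite AE => -[i Ji Px] nUx.
  have [_ lamw _ _] := HU i Ji; apply: lamw; split=> // Ux.
  by apply: nUx; exists i.
- rewrite /mass /wmass !fsum_bigcup// mulr_fsumr; apply: ler_fsum => // i Ji.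
  by have [] := HU i Ji.
- rewrite /mass /wmass !fsum_bigcup// mulr_fsumr; apply: ler_fsum => // i Ji.
  by have [] := HU i Ji.
Qed.

(** Decompose A at the level B times the average a of 1 / w with respect to
    w mu.  Outside U the power of 1 / w is at most (B a / c')^eps, which
    is 3 / 2 a^eps by the choice of eps.  On U the induction hypothesis bounds
    the sum by 6 (B a / c')^eps mu(U) = 9 a^eps mu(U).  As U has at most half
    of the mass, the total is at most 21 / 4 a^eps mu(A), and 21 / 4 < 6. *)
Lemma reverse_holder (R : realType) (T : choiceType) (mu w : T -> R)
    (c c' B eps : R) (D : nat -> set (set T)) :
  (forall x, 0 < mu x) -> (forall x, 0 < w x) ->
  0 < c' <= 1 -> 1 <= B -> 0 < eps -> (B / c') `^ eps = 3 / 2 ->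
  splitting mu c D -> (forall m A, D m A -> finite_set A /\ A !=set0) ->
  (forall m A k P, D m A -> D k P -> P `<=` A ->
     c * mass mu A <= mass mu P -> c' * wmass mu w A <= wmass mu w P) ->
  (forall m A U, D m A -> U `<=` A -> B * wmass mu w U <= wmass mu w A ->
     2 * mass mu U <= mass mu A) ->
  forall n A, D n A ->
    wmass mu (fun x => w x `^ (- eps)) A <=
    6 * (mass mu A / wmass mu w A) `^ eps * mass mu A.
Proof.
move=> mu0 w0 /andP[c'0 c'1] B1 eps0 BE splitD finD doubD smallD.
have B0 : 0 < B by exact: lt_le_trans B1.
elim/ltn_ind => n IH A DA; have [finA A0] := finD n A DA.
have mA := mass_gt0 mu0 finA A0; have wA := wmass_gt0 mu0 w0 finA A0.
have [a aE] : {a | mass mu A / wmass mu w A = a}.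
  by exists (mass mu A / wmass mu w A).
have a0 : 0 < a by rewrite -aE divr_gt0.
have muE : mass mu A = a * wmass mu w A by rewrite -aE mulfVK ?gt_eqF.
rewrite aE; set Phi := wmass mu _.
have powE : (B * a / c') `^ eps = 3 / 2 * a `^ eps.
  by rewrite -BE -powRM ?divr_ge0 ?ltW// mulrAC.
have [U [UA wU lamU PhiU]] : exists U, [/\ U `<=` A,
    forall x, (A `\` U) x -> 1 <= B * a * w x,
    B * a * wmass mu w U <= mass mu U &
    Phi U <= 9 * a `^ eps * mass mu U].
  apply: (calderon_zygmund mu0 w0 _ c'0 splitD _ doubD _ DA).
  - by rewrite mulr_gt0.
  - by move=> m Q /finD[].
  - move=> m Q mn DQ Qlam; have [finQ Q0] := finD m Q DQ.
    have mQ := mass_gt0 mu0 finQ Q0; have wQ := wmass_gt0 mu0 w0 finQ Q0.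
    apply: le_trans (IH m mn Q DQ) _; rewrite ler_pM2r//.
    have -> : 9 * a `^ eps = 6 * (B * a / c') `^ eps by rewrite powE; lra.
    rewrite ler_pM2l//; apply: ge0_ler_powR; first exact: ltW.
    + by rewrite nnegrE divr_ge0 ?ltW.
    + by rewrite nnegrE divr_ge0 ?mulr_ge0 ?ltW.
    + by rewrite ler_pdivrMr// mulrAC ler_pdivlMr// mulrC.
  - by rewrite muE ler_pM2r// ler_peMl// ltW.
have AU : Phi (A `\` U) <= 3 / 2 * a `^ eps * mass mu (A `\` U).
  rewrite mulr_fsumr; apply: ler_fsum; first exact: finite_setD.
  move=> x /wU lamw; rewrite ler_pM2r//.
  rewrite -mulN1r powRrM powR_inv1 ?(ltW (w0 x))// -powE.
  apply: ge0_ler_powR; first exact: ltW.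
  - by rewrite nnegrE invr_ge0 ltW.
  - by rewrite nnegrE divr_ge0 ?mulr_ge0 ?ltW.
  - by rewrite ler_pdivlMr// mulrC ler_pdivrMr//; exact: le_trans lamw.
have small : 2 * mass mu U <= mass mu A.
  apply: (smallD _ _ _ DA UA).
  rewrite -(@ler_pM2l _ a)// -muE mulrCA mulrA; apply: le_trans lamU _.
  exact: (ler_mass mu0 finA UA).
have muAU := massU mu finA UA.
have PhiAU := @massU _ _ (fun x => w x `^ (- eps) * mu x) A U finA UA.
rewrite -!wmassE -/Phi in PhiAU; rewrite PhiAU.
have t0 : 0 < a `^ eps by exact: powR_gt0.
move: (a `^ eps) t0 PhiU AU => t t0 PhiU AU.
have tA : 0 <= t * mass mu A by rewrite mulr_ge0 ?ltW.
have tU : t * (2 * mass mu U) <= t * mass mu A by rewrite ler_pM2l.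
have tAU : t * mass mu A = t * mass mu U + t * mass mu (A `\` U).
  by rewrite -mulrDr -muAU.
lra.
Qed.

(** A piece P of mu-mass at least c mu(A) leaves A minus P a mu-mass at most
    (1 - c) mu(A), so the hypothesis for xi = 1 - c bounds the w-mass of P
    from below.  For xi = 1 / 2 it shows that a set with w-mass at most
    wmass A / B has at most half the mu-mass.  The reverse Hoelder inequality
    with exponent eps then gives A_p for p = 1 + 1 / eps. *)
Lemma Ap_of_wmass_control (R : realType) (T : choiceType)
    (mu w : T -> R) (c : R) (D : nat -> set (set T)) :
  (forall x, 0 < mu x) -> (forall x, 0 < w x) -> 0 < c < 1 ->
  splitting mu c D -> (forall m A, D m A -> finite_set A /\ A !=set0) ->
  (forall xi : R, 0 < xi < 1 -> exists eta : R, 0 < eta < 1 /\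
     forall m A S, D m A -> S `<=` A -> mass mu S <= xi * mass mu A ->
       wmass mu w S <= eta * wmass mu w A) ->
  exists p C : R, 1 < p /\ forall m A, D m A -> avg mu w A *
     avg mu (fun y => w y `^ (- (p - 1)^-1)) A `^ (p - 1) <= C.
Proof.
move=> mu0 w0 /andP[c0 c1] splitD finD wD.
have [|eta1 [/andP[eta1_0 eta1_1] wD1]] := wD (1 - c).
  by rewrite subr_gt0 c1 gtrBl c0.
have [|eta2 [/andP[eta2_0 eta2_1] wD2]] := wD (1 / 2); first by lra.
have c'0 : 0 < 1 - eta1 by rewrite subr_gt0.
have e20 : 0 < 1 - eta2 by rewrite subr_gt0.
pose B := 2 / (1 - eta2).
have B2 : 2 <= B by rewrite ler_pdivlMr//; lra.
have M1 : 1 < B / (1 - eta1) by rewrite ltr_pdivlMr//; lra.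
have lnM0 := ln_gt0 M1.
have [eps eps0 BE] : exists2 eps, 0 < eps & (B / (1 - eta1)) `^ eps = 3 / 2.
  exists (ln (3 / 2) / ln (B / (1 - eta1))).
    by rewrite divr_gt0// ln_gt0//; lra.
  have M0 : 0 < B / (1 - eta1) by exact: lt_trans M1.
  apply: ln_inj; rewrite ?posrE ?powR_gt0 ?divr_gt0//.
  by rewrite ln_powR mulfVK// gt_eqF.
have doubD m A k P : D m A -> D k P -> P `<=` A ->
    c * mass mu A <= mass mu P -> (1 - eta1) * wmass mu w A <= wmass mu w P.
  move=> DA _ PA cP; have [finA _] := finD m A DA.
  have AP := massU mu finA PA.
  have := massU (fun x => w x * mu x) finA PA; rewrite -!wmassE => wAP.
  have : wmass mu w (A `\` P) <= eta1 * wmass mu w A.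
    by apply: (wD1 _ _ _ DA); [exact: subDsetl|lra].
  lra.
have smallD m A U : D m A -> U `<=` A -> B * wmass mu w U <= wmass mu w A ->
    2 * mass mu U <= mass mu A.
  move=> DA UA BU; have [finA A0] := finD m A DA.
  have wA := wmass_gt0 mu0 w0 finA A0.
  have AU := massU mu finA UA.
  have := massU (fun x => w x * mu x) finA UA; rewrite -!wmassE => wAU.
  rewrite leNgt; apply/negP => mU.
  have : wmass mu w (A `\` U) <= eta2 * wmass mu w A.
    by apply: (wD2 _ _ _ DA); [exact: subDsetl|lra].
  move: BU; rewrite /B mulrAC ler_pdivrMr//; nra.
have RH := @reverse_holder _ _ _ _ c (1 - eta1) B eps D mu0 w0 _ _ eps0 BE
  splitD finD doubD smallD.
exists (1 + eps^-1), (6 `^ eps^-1); split; first by rewrite ltrDl invr_gt0.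
move=> m A DA; rewrite addrAC subrr add0r invrK.
have [finA A0] := finD m A DA.
have mA := mass_gt0 mu0 finA A0; have wA := wmass_gt0 mu0 w0 finA A0.
have v0 x : 0 < w x `^ (- eps) by exact: powR_gt0.
have vA := wmass_gt0 mu0 v0 finA A0.
rewrite -ler_pdivlMl; last by rewrite avgE divr_gt0.
rewrite !avgE invf_div.
have -> : mass mu A / wmass mu w A * 6 `^ eps^-1 =
    (6 * (mass mu A / wmass mu w A) `^ eps) `^ eps^-1.
  rewrite powRM ?powR_ge0// -powRrM divff ?gt_eqF// powRr1.
    by rewrite mulrC.
  by rewrite divr_ge0 ?ltW.
apply: ge0_ler_powR; first by rewrite invr_ge0 ltW.
- by rewrite nnegrE divr_ge0 ?ltW.
- by rewrite nnegrE mulr_ge0 ?powR_ge0.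
- rewrite ler_pdivrMr//; apply: (RH _ _ m) => //; [lra|lra].
Qed.

(** * Simple paths and geodesic rays in a tree *)

(** If the paths part at x, follow the second one up to its first vertex z on
    the first one, and come back to x along the first one: this is a cycle,
    of length at least 3 because the paths start with different edges. *)
Lemma simple_path_unique (T : choiceType) (e : rel T) (x : T) (p q : seq T) :
  is_tree e -> path e x p -> path e x q -> uniq (x :: p) -> uniq (x :: q) ->
  last x p = last x q -> p = q.
Proof.
move=> [syme _ _ acyc]; elim: p x q => [|a p IH] x [|b q] //.
- by move=> _ _ _ /= /andP[+ _] xE; rewrite xE mem_last.
- by move=> _ _ /= /andP[+ _] _ xE; rewrite -xE mem_last.
have [<-{b}|ab] := eqVneq a b.
  move=> /= /andP[_ ap] /andP[_ aq] /andP[_ up] /andP[_ uq] pq.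
  by rewrite (IH a q).
move=> xp xq up uq pq; exfalso.
have : has [in a :: p] (b :: q).
  apply/hasP; exists (last b q); first exact: mem_last.
  by have /= <- := pq; exact: mem_last.
have : head x (a :: p) != head x (b :: q) by [].
move: (a :: p) (b :: q) xp xq up uq => {}p {pq IH ab}q xp xq up uq hd hasq.
move: xq uq hd; case/split_find: hasq => z q1 q2 zp q1p xq uq.
move: xp up q1p; case/splitPr: zp => p1 p2 xp up q1p hd.
pose c := x :: p1 ++ z :: rev q1.
suff /acyc : ucycle e c.
  rewrite /c /= size_cat /= size_rev.
  case: p1 hd {c xp up q1p} => [|? ?] hd /=; last lia.
  by case: q1 {xq uq} hd => [|? ?] /=; rewrite ?eqxx//; lia.
apply/andP; split.
  rewrite /c /= rcons_cat cat_path /= rcons_path.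
  move: xp; rewrite cat_path /= => /and3P[-> -> _] /=.
  move: xq; rewrite cat_path => /andP[xq _].
  have := rev_path e x (rcons q1 z).
  rewrite last_rcons belast_rcons rev_cons rcons_path => ->.
  by rewrite (eq_path (e' := e))// => u v; rewrite syme.
move: up; rewrite /c cons_uniq mem_cat inE => /andP[/norP[xp1 /norP[xz _]]].
rewrite cat_uniq /= => /and4P[up1 /norP[zp1 _] _ _].
move: uq; rewrite cons_uniq mem_cat mem_rcons inE.
move=> /andP[/norP[/norP[_ xq1] _]].
rewrite cat_uniq rcons_uniq => /andP[/andP[zq1 uq1] _].
rewrite /= mem_cat inE mem_rev (negbTE xp1) (negbTE xz) (negbTE xq1) /=.
rewrite cat_uniq up1 /= negb_or zp1 mem_rev zq1 rev_uniq uq1 !andbT /=.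
apply/hasPn => u; rewrite mem_rev => uq1'; apply/negP => up1'.
by move/hasPn: q1p => /(_ u uq1'); rewrite /= mem_cat up1'.
Qed.

Lemma tdist_simple_path (T : choiceType) (e : rel T) (x : T) (p : seq T) :
  is_tree e -> path e x p -> uniq (x :: p) -> tdist e x (last x p) = size p.
Proof.
move=> treeE xp up.
have min_p m : walk_length e x (last x p) m -> (size p <= m)%N.
  move=> [q [xq lq <-]]; move: lq; case: (shortenP xq) => q' xq' uq' qq' lq'.
  rewrite (simple_path_unique treeE xp xq' up uq' (esym lq')).
  by apply: uniq_leq_size => //; case/andP: uq'.
have wp : walk_length e x (last x p) (size p) by exists p.
rewrite /tdist; apply: xget_unique => [|n [wn minn]]; first by split.
by apply/eqP; rewrite eqn_leq minn// min_p.
Qed.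

Lemma ex_simple_path (T : choiceType) (e : rel T) (x y : T) : is_tree e ->
  exists p, [/\ path e x p, uniq (x :: p) & last x p = y].
Proof.
move=> [_ _ conn _]; have [p xp <-] := conn x y.
by case: (shortenP xp) => q xq uq _; exists q.
Qed.

Lemma tdist_sym (T : choiceType) (e : rel T) (x y : T) : is_tree e ->
  tdist e x y = tdist e y x.
Proof.
move=> [syme _ _ _]; rewrite /tdist.
suff walk_sym a b n : walk_length e a b n -> walk_length e b a n.
  have -> // : walk_length e x y = walk_length e y x.
  by apply/seteqP; split=> n; exact: walk_sym.
move=> [p [ap <- <-]]; exists (rev (belast a p)); split.
- by rewrite rev_path (eq_path (e' := e))// => u v; rewrite syme.
- by case: p {ap} => //= c p; rewrite rev_cons last_rcons.
- by rewrite size_rev size_belast.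
Qed.

Lemma tdist_xx (T : choiceType) (e : rel T) (x : T) : is_tree e ->
  tdist e x x = 0%N.
Proof. by move=> treeE; apply: (@tdist_simple_path _ e x [::]). Qed.

Lemma tdist_eq0 (T : choiceType) (e : rel T) (x y : T) : is_tree e ->
  tdist e x y = 0%N -> x = y.
Proof.
move=> treeE; have [p [xp up <-]] := ex_simple_path x y treeE.
by rewrite tdist_simple_path//; case: p {xp up}.
Qed.

Lemma tdist_eq1 (T : choiceType) (e : rel T) (x y : T) : is_tree e ->
  tdist e x y = 1%N -> e x y.
Proof.
move=> treeE; have [p [xp up <-]] := ex_simple_path x y treeE.
rewrite tdist_simple_path//; case: p xp up => [|a [|b p]]//=.
by rewrite andbT.
Qed.

(** The initial vertex [g 0] is left out, as in the arguments of [path]. *)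
Definition segment (T : choiceType) (g : nat -> T) (n : nat) : seq T :=
  [seq g k | k <- iota 1 n].

Lemma path_segment (T : choiceType) (e : rel T) (g : nat -> T) (n : nat) :
  (forall i, e (g i) (g i.+1)) -> path e (g 0%N) (segment g n).
Proof.
move=> eg; rewrite /segment; elim: n 0%N => [|n IH] i //=.
by rewrite eg IH.
Qed.

Lemma last_segment (T : choiceType) (g : nat -> T) (n : nat) :
  last (g 0%N) (segment g n) = g n.
Proof.
rewrite /segment last_map; case: n => // n.
by rewrite -[X in iota _ X]addn1 iotaD last_cat.
Qed.

Lemma uniq_segment (T : choiceType) (g : nat -> T) (n : nat) :
  injective g -> uniq (g 0%N :: segment g n).
Proof.
move=> injg; rewrite -[_ :: _]/(map g (iota 0 n.+1)).
by rewrite map_inj_uniq// iota_uniq.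
Qed.

(** An injective sequence of adjacent vertices runs along simple paths, and a
    simple path in a tree is the shortest one. *)
Lemma geodesic_rayP (T : choiceType) (e : rel T) (g : nat -> T) : is_tree e ->
  geodesic_ray e g <-> (forall i, e (g i) (g i.+1)) /\ injective g.
Proof.
move=> treeE; split=> [geog|[eg injg]].
  split=> [i|i j gij].
    by apply: tdist_eq1 => //; rewrite geog// subSnn.
  wlog ij : i j gij / (i <= j)%N.
    by move=> H; case/orP: (leq_total i j) => /H => [->//|/(_ (esym gij))].
  have := geog _ _ ij; rewrite gij tdist_xx//; lia.
move=> i j ij; pose h k := g (i + k)%N.
have eh k : e (h k) (h k.+1) by rewrite /h addnS.
have injh : injective h by move=> k l /injg/addnI.
have := @tdist_simple_path _ e (h 0%N) (segment h (j - i)) treeE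
  (path_segment _ eh) (uniq_segment _ injh).
by rewrite last_segment size_map size_iota /h addn0 subnKC.
Qed.

(** The initial segments of both rays up to a common vertex are simple paths
    with the same endpoints. *)
Lemma geodesic_ray_unique (T : choiceType) (e : rel T) (g h : nat -> T) :
  is_tree e -> geodesic_ray e g -> geodesic_ray e h -> g 0%N = h 0%N ->
  eventually_coincide g h -> g = h.
Proof.
move=> treeE /(geodesic_rayP _ treeE)[eg injg].
move=> /(geodesic_rayP _ treeE)[eh injh] gh0 [m [n gh]].
have segE k : segment g (m + k) = segment h (n + k).
  apply: (@simple_path_unique _ e (g 0%N)) => //.
  - exact: path_segment.
  - by rewrite gh0; exact: path_segment.
  - exact: uniq_segment.
  - by rewrite gh0; exact: uniq_segment.
  - by rewrite last_segment gh0 last_segment gh.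
have mn : m = n.
  by have /(congr1 size) := segE 0%N; rewrite !size_map !size_iota; lia.
apply/funext => k; have := segE k; rewrite -mn => /eq_in_map ghE.
case: k ghE => // k; apply; rewrite mem_iota; lia.
Qed.

Lemma eventually_coincide_trans (T : choiceType) (g1 g2 g3 : nat -> T) :
  eventually_coincide g1 g2 -> eventually_coincide g1 g3 ->
  eventually_coincide g2 g3.
Proof.
move=> [m [n gh]] [m' [n' gh']]; exists (n + m')%N, (n' + m)%N => k.
by rewrite -!addnA -gh -gh' !addnA (addnC m).
Qed.

(** * The parent map of a boundary point *)

Lemma boundary_geodesic (T : choiceType) (e : rel T) (omega : set (nat -> T))
    (g : nat -> T) : boundary e omega -> omega g -> geodesic_ray e g.
Proof. by move=> [h _ ->] []. Qed.

Lemma boundary_coincide (T : choiceType) (e : rel T) (omega : set (nat -> T))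
    (g h : nat -> T) :
  boundary e omega -> omega g -> omega h -> eventually_coincide g h.
Proof. by move=> [k _ ->] [_ kg] [_ /(eventually_coincide_trans kg)]. Qed.

Lemma boundary_mem (T : choiceType) (e : rel T) (omega : set (nat -> T))
    (g h : nat -> T) : boundary e omega -> omega g -> geodesic_ray e h ->
  eventually_coincide g h -> omega h.
Proof.
move=> [k _ ->] [_ [m [n kg]]] geoh [m' [n' gh]]; split=> //.
exists (m + m')%N, (n' + n)%N => i.
by rewrite -!addnA kg addnCA gh addnCA.
Qed.

Lemma boundary_unique (T : choiceType) (e : rel T) (omega : set (nat -> T))
    (g h : nat -> T) : is_tree e -> boundary e omega ->
  omega g -> omega h -> g 0%N = h 0%N -> g = h.
Proof.
move=> treeE bo og oh gh0; apply: (geodesic_ray_unique treeE _ _ gh0).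
- exact: boundary_geodesic bo og.
- exact: boundary_geodesic bo oh.
- exact: boundary_coincide bo og oh.
Qed.

Lemma boundary_shift (T : choiceType) (e : rel T) (omega : set (nat -> T))
    (g : nat -> T) :
  boundary e omega -> omega g -> omega (fun k => g k.+1).
Proof.
move=> bo og; apply: (boundary_mem bo og).
  by move=> i j ij; rewrite (boundary_geodesic bo og)// subSS.
by exists 1%N, 0%N => k; rewrite add1n.
Qed.

(** The vertex y does not occur on g, since y = g k would make the one-edge
    path from g 0 to y a second simple path, forcing k = 1; hence the
    prolonged sequence is still injective. *)
Lemma boundary_cons (T : choiceType) (e : rel T) (omega : set (nat -> T))
    (g : nat -> T) (y : T) : is_tree e -> boundary e omega -> omega g ->
  e y (g 0%N) -> y != g 1%N -> omega (fun k => if k is k'.+1 then g k' else y).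
Proof.
move=> treeE bo og yg yg1.
have [eg injg] := (geodesic_rayP g treeE).1 (boundary_geodesic bo og).
have [syme irre _ _] := treeE.
have yNg k : y <> g k.
  move=> ygk; have := @tdist_simple_path _ e (g 0%N) (segment g k) treeE
    (path_segment _ eg) (uniq_segment _ injg).
  rewrite last_segment size_map size_iota -ygk.
  have gy : g 0%N != y by apply/eqP => gy; move: yg; rewrite gy irre.
  have := @tdist_simple_path _ e (g 0%N) [:: y] treeE.
  rewrite /= inE syme yg gy => /(_ isT isT) -> k1.
  by move: ygk yg1; rewrite -k1 => ->; rewrite eqxx.
apply: (boundary_mem bo og); last by exists 0%N, 1%N => k.
apply/geodesic_rayP => //; split=> [[|i]|[|i] [|j]]//.
- by move=> /yNg.
- by move=> /esym /yNg.
- by move=> /injg ->.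
Qed.

(** Start from a ray of omega and walk to x: each step either goes along the
    current ray, which is then shortened, or away from it, and then the ray is
    prolonged. *)
Lemma boundary_ex (T : choiceType) (e : rel T) (omega : set (nat -> T))
    (x : T) : is_tree e -> boundary e omega -> exists g, omega g /\ g 0%N = x.
Proof.
move=> treeE bo; have [g0 og0] : exists g, omega g.
  move: bo => [g geog ->]; exists g; split=> //.
  by exists 0%N, 0%N => k.
have [syme _ conn _] := treeE.
have [p gp <-] := conn (g0 0%N) x.
have : exists g, omega g /\ g 0%N = g0 0%N by exists g0.
elim: p (g0 0%N) gp => //= y p IH z /andP[zy yp] [g [og gz]].
apply: IH yp _; have [yE|yN] := eqVneq y (g 1%N).
  by exists (fun k => g k.+1); split; [exact: boundary_shift bo og|].
exists (fun k => if k is k'.+1 then g k' else y); split=> //.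
by apply: (boundary_cons treeE bo og) => //; rewrite gz syme.
Qed.

Lemma ray_mem (T : choiceType) (e : rel T) (omega : set (nat -> T)) (x : T) :
  is_tree e -> boundary e omega -> omega (ray omega x) /\ ray omega x 0%N = x.
Proof.
move=> treeE bo; apply: (@xgetPex _ (fun=> x) [set g | omega g /\ g 0%N = x]).
exact: boundary_ex treeE bo.
Qed.

Definition parent (T : choiceType) (omega : set (nat -> T)) (x : T) : T :=
  ray omega x 1%N.

Lemma rayE (T : choiceType) (e : rel T) (omega : set (nat -> T)) (x : T)
    (n : nat) : is_tree e -> boundary e omega ->
  ray omega x n = iter n (parent omega) x.
Proof.
move=> treeE bo; elim: n x => [|n IH] x.
  by have [_ ->] := ray_mem x treeE bo.
rewrite iterSr -IH /parent.
have [ox _] := ray_mem x treeE bo.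
have [opx opx0] := ray_mem (ray omega x 1%N) treeE bo.
by rewrite (boundary_unique treeE bo opx (boundary_shift bo ox) opx0).
Qed.

Lemma tdist_iter_parent (T : choiceType) (e : rel T) (omega : set (nat -> T))
    (x : T) (n : nat) : is_tree e -> boundary e omega ->
  tdist e x (iter n (parent omega) x) = n.
Proof.
move=> treeE bo; have [ox ox0] := ray_mem x treeE bo.
by rewrite -(rayE x n treeE bo) -{1}ox0 (boundary_geodesic bo ox)// subn0.
Qed.

Lemma iter_parent_inj (T : choiceType) (e : rel T) (omega : set (nat -> T))
    (x : T) (m n : nat) : is_tree e -> boundary e omega ->
  iter m (parent omega) x = iter n (parent omega) x -> m = n.
Proof.
move=> treeE bo mn; rewrite -(tdist_iter_parent x m treeE bo) mn.
exact: tdist_iter_parent.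
Qed.

(** If y is not the next vertex of the ray from x, then y followed by this ray
    is the ray from y. *)
Lemma edge_parent (T : choiceType) (e : rel T) (omega : set (nat -> T))
    (x y : T) : is_tree e -> boundary e omega -> e x y ->
  parent omega x = y \/ parent omega y = x.
Proof.
move=> treeE bo xy; have [ox ox0] := ray_mem x treeE bo.
have [syme _ _ _] := treeE.
have [yE|yN] := eqVneq y (ray omega x 1%N); first by left.
right; have [oy oy0] := ray_mem y treeE bo.
rewrite /parent.
rewrite (boundary_unique treeE bo oy (boundary_cons treeE bo ox _ yN))//.
by rewrite ox0 syme.
Qed.

Lemma parent_edge (T : choiceType) (e : rel T) (omega : set (nat -> T))
    (x : T) : is_tree e -> boundary e omega -> e x (parent omega x).
Proof.
by move=> treeE bo; apply: tdist_eq1 => //; exact: (tdist_iter_parent x 1).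
Qed.

Lemma iter_parent_meet (T : choiceType) (e : rel T) (omega : set (nat -> T))
    (x y : T) : is_tree e -> boundary e omega ->
  exists m n, iter m (parent omega) x = iter n (parent omega) y.
Proof.
move=> treeE bo; have [ox _] := ray_mem x treeE bo.
have [oy _] := ray_mem y treeE bo.
have [m [n xy]] := boundary_coincide bo ox oy.
by exists m, n; have := xy 0%N; rewrite !addn0 !(rayE _ _ treeE bo).
Qed.

(** The sequence defining the level is eventually constant: beyond the common
    vertex, the geodesic from x to the ray of o runs along that ray. *)
Lemma level_meet (R : realType) (T : choiceType) (e : rel T)
    (omega : set (nat -> T)) (o x : T) (m n : nat) :
  is_tree e -> boundary e omega ->
  iter m (parent omega) x = iter n (parent omega) o ->
  level R e omega o x = n%:R - m%:R.
Proof.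
move=> treeE bo xo; apply: lim_near_cst => //.
near=> k; have nk : (n <= k)%N by near: k; exact: nbhs_infty_ge.
rewrite (rayE _ _ treeE bo) -(subnK nk) iterD -xo -iterD tdist_iter_parent//.
by rewrite !natrD; ring.
Unshelve. all: by end_near.
Qed.

Lemma successorsE (R : realType) (T : choiceType) (e : rel T)
    (omega : set (nat -> T)) (o x : T) : is_tree e -> boundary e omega ->
  successors R e omega o x = [set y | parent omega y = x].
Proof.
move=> treeE bo; have [syme _ _ _] := treeE.
apply/seteqP; split=> y /=.
  move=> [xy ly]; have [xpy|//] := edge_parent treeE bo xy.
  have [m [n yo]] := iter_parent_meet y o treeE bo.
  have xo : iter m.+1 (parent omega) x = iter n (parent omega) o.
    by rewrite iterSr xpy.
  move: ly; rewrite (level_meet R treeE bo yo) (level_meet R treeE bo xo).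
  by rewrite -natr1; clear=> lxy; exfalso; lra.
move=> yx; split; first by rewrite syme -yx; exact: parent_edge.
have [m [n xo]] := iter_parent_meet x o treeE bo.
have yo : iter m.+1 (parent omega) y = iter n (parent omega) o.
  by rewrite iterSr yx.
rewrite (level_meet R treeE bo yo) (level_meet R treeE bo xo).
by rewrite -natr1; ring.
Qed.

(** * Flow measures along the parent map *)

(** Doubling for the balls of radius 1 / 2 and 1 around y: the first is {y}, and
    the second contains the parent of y. *)
Lemma parent_doubling (R : realType) (T : choiceType) (e : rel T)
    (omega : set (nat -> T)) (mu : T -> R) :
  is_tree e -> boundary e omega -> (forall x, 0 < mu x) ->
  locally_doubling e mu ->
  exists2 d, 0 < d <= 1 & forall y, d * mu (parent omega y) <= mu y.
Proof.
move=> treeE bo mu0 /(_ (1 / 2)) [|D doub]; first by lra.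
have DP y : mu (parent omega y) <= Num.max D 1 * mu y.
  apply: (@le_trans _ _ (D * mu y)); last by rewrite ler_pM2r// le_max lexx.
  have ball1 : tball e y (1 / 2 : R) = [set y].
    apply/seteqP; split=> z; rewrite /tball /=; last first.
      by move=> ->; rewrite tdist_xx//; lra.
    case E : (tdist e y z) => [|n].
      by move=> _; rewrite (tdist_eq0 treeE E).
    by move=> yz; exfalso; have := ler0n R n; move: yz; rewrite -natr1; lra.
  have := doub y; rewrite ball1 esum_set1; last by rewrite lee_fin ltW.
  rewrite -EFinM -lee_fin; apply: le_trans; apply: esum_ge.
  exists [set parent omega y]; last by rewrite fsbig_set1.
  split=> // z ->; rewrite /tball /=.
  by rewrite (tdist_iter_parent y 1 treeE bo); lra.
have M0 : 0 < Num.max D 1 by rewrite lt_max ltr01 orbT.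
exists (Num.max D 1)^-1.
  by rewrite invr_gt0 M0 invf_le1// le_max lexx orbT.
by move=> y; rewrite ler_pdivrMl.
Qed.

Definition flow_map (R : realType) (T : choiceType) (mu : T -> R)
    (f : T -> T) : Prop :=
  forall x, finite_set [set y | f y = x] /\ mass mu [set y | f y = x] = mu x.

(** Each successor of x has at least the fixed fraction d of the mass of x,
    so the flow identity leaves room for at most 1 / d of them. *)
Lemma flow_parent (R : realType) (T : choiceType) (e : rel T)
    (omega : set (nat -> T)) (o : T) (mu : T -> R) (d : R) :
  is_tree e -> boundary e omega -> flow_measure e omega o mu ->
  0 < d -> (forall y, d * mu (parent omega y) <= mu y) ->
  flow_map mu (parent omega).
Proof.
move=> treeE bo [mu0 flow] d0 dP x /=.
set S := [set y | _]; have muS : (mu x)%:E = \esum_(y in S) (mu y)%:E.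
  by rewrite flow successorsE.
have finS : finite_set S.
  apply: contrapT => infS.
  have [B BS sB] := infinite_set_fset (Num.trunc (d^-1)).+1 infS.
  have : ((\sum_(y \in [set` B]) mu y)%:E <= (mu x)%:E)%E.
    rewrite muS; apply: esum_ge; exists [set` B] => //.
    by rewrite fsumEFin.
  rewrite lee_fin leNgt => /negP; apply.
  apply: (@lt_le_trans _ _ (\sum_(y \in [set` B]) d * mu x)); last first.
    by apply: ler_fsum => // y /BS <-.
  rewrite fsbig_finite//= set_fsetK big_const_seq count_predT iter_addr_0.
  rewrite -mulr_natr mulrAC -[ltLHS]mul1r ltr_pM2r// mulrC -ltr_pdivrMr// mul1r.
  by apply: lt_le_trans (truncnS_gt _) _; rewrite ler_nat.
split=> //; apply: EFin_inj; rewrite muS esum_fset//.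
  by rewrite fsumEFin.
by move=> y _; rewrite lee_fin ltW.
Qed.

Definition descendants (T : Type) (f : T -> T) (n : nat) (x : T) : set T :=
  [set y | iter n f y = x].

Definition strip (T : Type) (f : T -> T) (x : T) (h1 h2 : nat) : set T :=
  \bigcup_(n in [set n | (h1 <= n < h2)%N]) descendants f n x.

Lemma trapezoidE (T : choiceType) (e : rel T) (omega : set (nat -> T))
    (x : T) (h1 h2 : nat) : is_tree e -> boundary e omega ->
  trapezoid e omega x h1 h2 = strip (parent omega) x h1 h2.
Proof.
move=> treeE bo; apply/seteqP; split=> y.
  move=> [[n]]; rewrite (rayE _ _ treeE bo) => yx.
  by rewrite tdist_sym// -yx (tdist_iter_parent y n treeE bo) => hn; exists n.
move=> [n /= hn yx]; split; first by exists n; rewrite (rayE _ _ treeE bo).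
by rewrite tdist_sym// -yx (tdist_iter_parent y n treeE bo).
Qed.

(** The flow identity iterated n times: each generation below x has the mass
    of x. *)
Lemma descendants_mass (R : realType) (T : choiceType) (f : T -> T)
    (mu : T -> R) (n : nat) (x : T) :
  flow_map mu f ->
  finite_set (descendants f n x) /\ mass mu (descendants f n x) = mu x.
Proof.
move=> flow; elim: n x => [|n IH] x.
  have -> : descendants f 0 x = [set x] by [].
  by split=> //; rewrite /mass fsbig_set1.
have [finx mux] := flow x.
have -> : descendants f n.+1 x =
    \bigcup_(y in [set y | f y = x]) descendants f n y.
  apply/seteqP; split=> [z zx|z [y <- <-]//].
  by exists (iter n f z).
split; first by apply: bigcup_finite => // y _; have [] := IH y.
rewrite /mass fsum_bigcup//.
- by rewrite -mux; apply: eq_fsbigr => y _; have [_] := IH y.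
- by move=> y _; have [] := IH y.
- by move=> y z _ _ [t [<- <-]].
Qed.

Lemma strip_mass (R : realType) (T : choiceType) (f : T -> T)
    (mu : T -> R) (x : T) (h1 h2 : nat) :
  (forall x m n, iter m f x = iter n f x -> m = n) ->
  flow_map mu f ->
  finite_set (strip f x h1 h2) /\
  mass mu (strip f x h1 h2) = (h2 - h1)%:R * mu x.
Proof.
move=> injf flow.
have stripE : strip f x h1 h2 =
    \bigcup_(i in `I_(h2 - h1)) descendants f (h1 + i) x.
  apply/seteqP; split=> y [n /= hn yx].
    exists (n - h1)%N; first by rewrite /=; lia.
    by rewrite subnKC//; lia.
  by exists (h1 + n)%N => //=; lia.
have fin n := (descendants_mass n x flow).1.
rewrite stripE; split; first by apply: bigcup_finite.
rewrite /mass fsum_bigcup//; last first.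
  by move=> i j _ _ [y [/= yi yj]]; apply/(@addnI h1)/(injf y); rewrite yi yj.
rewrite -fsbig_ord (eq_bigr (fun=> mu x)) => [|i _].
  by rewrite sumr_const card_ord mulr_natl.
by have [_] := descendants_mass (h1 + i) x flow.
Qed.

(** * Splitting trapezoids *)

Lemma admissibleE (R : realType) (beta : R) (h1 h2 : nat) :
  admissible beta h1 h2 <->
  [/\ (0 < h1)%N, (2 * h1 <= h2)%N & h2%:R <= beta * h1%:R].
Proof.
split=> [[h10 h12 /andP[h2h h2b]]|[h10 h12 h2b]].
  have h1R : 0 < h1%:R :> R by rewrite ltr0n.
  split=> //; last by rewrite -ler_pdivrMr.
  by rewrite -(ler_nat R) natrM -ler_pdivlMr.
have h1R : 0 < h1%:R :> R by rewrite ltr0n.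
split=> //; first lia.
by rewrite ler_pdivlMr// ler_pdivrMr// h2b andbT -natrM ler_nat.
Qed.

(** The rank 2 h2 - h1 decreases under each of the cuts: (h1, h2) becomes
    (h1, 2 h1) or (2 h1, h2) with 4 h1 <= h2, or (h1 - 1, h2 - 1). *)
Definition ranked_trapezoids (R : realType) (T : Type) (f : T -> T) (beta : R)
    (n : nat) : set (set T) :=
  [set A | (n = 0%N /\ exists x, A = [set x]) \/
           exists x h1 h2, [/\ admissible beta h1 h2, n = (2 * h2 - h1)%N &
                              A = strip f x h1 h2]].

Lemma ranked_trapezoids_finite (R : realType) (T : choiceType) (f : T -> T)
    (mu : T -> R) (beta : R) (n : nat) (A : set T) :
  (forall x, 0 < mu x) ->
  (forall x m n, iter m f x = iter n f x -> m = n) ->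
  flow_map mu f ->
  ranked_trapezoids f beta n A -> finite_set A /\ A !=set0.
Proof.
move=> mu0 injf flow [[_ [x ->]]|[x [h1 [h2 [[h10 h12 _] _ ->]]]]].
  by split=> //; exists x.
have [finA muA] := strip_mass x h1 h2 injf flow; split=> //.
apply/set0P/eqP => A0; move: muA; rewrite A0 /mass fsbig_set0 => /esym/eqP.
by rewrite mulf_eq0 (gt_eqF (mu0 x)) orbF pnatr_eq0; lia.
Qed.

(** A horizontal cut at 2 h1 leaves the proportions h1 / (h2 - h1), at least
    1 / beta, and (h2 - 2 h1) / (h2 - h1), at least 1 / 2.  A vertical cut has
    the proportions mu(y) / mu(x), at least d.  A singleton at distance at most
    2 below the root has at least d^2 mu(x), while the trapezoid has at most
    2 mu(x).  All are at least d^2 / beta. *)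
Lemma splitting_trapezoids (R : realType) (T : choiceType) (f : T -> T)
    (mu : T -> R) (beta d : R) :
  12 <= beta -> 0 < d <= 1 -> (forall x, 0 < mu x) ->
  (forall x m n, iter m f x = iter n f x -> m = n) ->
  flow_map mu f ->
  (forall y, d * mu (f y) <= mu y) ->
  splitting mu (d ^+ 2 / beta) (ranked_trapezoids f beta).
Proof.
move=> beta12 /andP[d0 d1] mu0 injf flow dmu n A.
have smass x a b := (strip_mass x a b injf flow).2.
have beta0 : 0 < beta by lra.
set c := d ^+ 2 / beta.
have cd2 : 2 * c <= d ^+ 2.
  by rewrite mulrA ler_pdivrMr// mulrC ler_pM2l ?exprn_gt0//; lra.
have d2d : d ^+ 2 <= d by rewrite expr2 ler_piMr// ltW.
have cb : c <= beta^-1.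
  by rewrite ler_piMl ?invr_ge0 ?(ltW beta0)// (le_trans d2d).
have c0 : 0 < c by rewrite divr_gt0// exprn_gt0.
case=> [[_ ?]|[x [h1 [h2 [/admissibleE[h10 h12 h2b] -> ->]]]]]; first by left.
have h1R : 0 < h1%:R :> R by rewrite ltr0n.
right; have [h42|h24] := leqP (4 * h1) h2.
  (* Horizontal cut at height 2 h1. *)
  exists bool, setT, (fun b => if b then strip f x h1 (2 * h1)
                               else strip f x (2 * h1) h2).
  split=> //.
  - exact: finite_finset.
  - move=> i j _ _; case: i j => [] [] // [y [[n1 /= hn1 y1] [n2 /= hn2 y2]]];
    have := injf y n1 n2; rewrite y1 y2 => /(_ erefl) n12; exfalso; lia.
  - apply/seteqP; split=> y.
      move=> [k /= hk yx]; have [k1|k1] := ltnP k (2 * h1).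
        by exists true => //; exists k => //=; lia.
      by exists false => //; exists k => //=; lia.
    by move=> [[] _ [k /= hk yx]]; exists k => //=; lia.
  - move=> [] _; rewrite !smass mulrA ler_pM2r//; split.
    + apply: (@le_trans _ _ (beta^-1 * h2%:R)).
        by apply: ler_pM => //; [exact: ltW|rewrite ler_nat leq_subr].
      rewrite ler_pdivrMl//; apply: le_trans h2b _.
      by rewrite ler_pM2l// ler_nat; lia.
    + exists (2 * (2 * h1) - h1)%N; first lia.
      right; exists x, h1, (2 * h1)%N; split=> //; apply/admissibleE.
      by split=> //; rewrite natrM ler_pM2r//; lra.
    + apply: (@le_trans _ _ (2^-1 * (h2 - h1)%:R)).
        by rewrite ler_wpM2r//; lra.
      by rewrite ler_pdivrMl// -natrM ler_nat; lia.
    + exists (2 * h2 - 2 * h1)%N; first lia.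
      right; exists x, (2 * h1)%N, h2; split=> //; apply/admissibleE.
      split=> //; [lia|lia|].
      by apply: le_trans h2b _; rewrite ler_pM2l// ler_nat; lia.
have [h1_1|h1_2] := leqP h1 1.
  have h1E : h1 = 1%N by lia.
  subst h1; exists T, (strip f x 1 h2), (fun y => [set y]).
  split=> //.
  - exact: (strip_mass _ _ _ injf flow).1.
  - by move=> y z _ _ [t [/= <- <-]].
  - by apply/seteqP; split=> [y|y [z sz ->]]//; exists y.
  - move=> y [k /= hk yx]; split; last first.
      by exists 0%N; [lia|left; split=> //; exists y].
    rewrite smass /mass fsbig_set1.
    apply: (@le_trans _ _ (d ^+ 2 * mu x)).
      rewrite mulrA ler_pM2r//; apply: le_trans cd2; rewrite mulrC ler_pM2r//.
      by rewrite (ler_nat R _ 2); lia.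
    rewrite -yx; have [->|->] : k = 1%N \/ k = 2%N by lia.
      rewrite /=; apply: le_trans (dmu y).
      by rewrite ler_pM2r.
    rewrite /= expr2 -mulrA; apply: le_trans (dmu y).
    by rewrite ler_pM2l.
(* Vertical cut: h1 >= 2 and h2 < 4 h1.  The new ratio is at most
   (4 h1 - 2) / (h1 - 1), which is less than 12. *)
exists T, [set y | f y = x], (fun y => strip f y h1.-1 h2.-1).
split=> //.
- exact: (flow x).1.
- move=> y z yx zx [t [[n1 /= hn1 t1] [n2 /= hn2 t2]]].
  have := injf t n1.+1 n2.+1; rewrite /= t1 t2 yx zx => /(_ erefl)[n12].
  by rewrite -t1 -t2 n12.
- apply/seteqP; split=> y.
    move=> [[|k] /= hk yx]; first lia.
    by exists (iter k f y) => //; exists k => //=; lia.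
  by move=> [z <- [k /= hk <-]]; exists k.+1 => //=; lia.
- move=> y /= yx; split.
    rewrite !smass (_ : h2.-1 - h1.-1 = h2 - h1)%N; last lia.
    rewrite mulrCA ler_wpM2l// -yx; apply: le_trans (dmu y).
    by rewrite ler_pM2r//; nra.
  exists (2 * h2.-1 - h1.-1)%N; first lia.
  right; exists y, h1.-1, h2.-1; split=> //.
  apply/admissibleE; split; [lia|lia|].
  apply: (@le_trans _ _ (12 * h1.-1%:R)); last by rewrite ler_wpM2r.
  by rewrite -(natrM R 12) ler_nat; lia.
Qed.

(** * Equivalence of the conditions *)

Lemma trapezoidsE (R : realType) (T : choiceType) (e : rel T)
    (omega : set (nat -> T)) (beta : R) (A : set T) :
  is_tree e -> boundary e omega ->
  trapezoids e omega beta A <->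
  exists n, ranked_trapezoids (parent omega) beta n A.
Proof.
move=> treeE bo; split.
  move=> [[x ->]|[x [h1 [h2 [adm ->]]]]].
    by exists 0%N; left; split=> //; exists x.
  by exists (2 * h2 - h1)%N; right; exists x, h1, h2; rewrite trapezoidE.
move=> [n [[_ [x ->]]|[x [h1 [h2 [adm _ ->]]]]]]; first by left; exists x.
by right; exists x, h1, h2; rewrite trapezoidE.
Qed.

Theorem theorem3p9 (R : realType) (T : choiceType) (e : rel T)
    (omega : set (nat -> T)) (o : T) (mu : T -> R) (beta : R) (w : T -> R)
    (T_infinite : infinite_set [set: T])
    (T_tree : is_tree e)
    (omega_boundary : boundary e omega)
    (mu_flow : flow_measure e omega o mu)
    (mu_doubling : locally_doubling e mu)
    (beta_ge12 : 12 <= beta)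
    (w_gt0 : forall x, 0 < w x) :
  [<->
    Ainfty e omega beta mu w;
    (Ainfty_const e omega beta mu w < +oo)%E;
    exists gamma0 : R, 0 < gamma0 < 1 /\
      exists delta : R -> R,
        (forall gamma : R, 0 < gamma < gamma0 ->
          0 < delta gamma < 1 /\
          forall A : set T, trapezoids e omega beta A ->
            mass mu [set x | A x /\ w x <= gamma / mass mu A * wmass mu w A]
              <= delta gamma * mass mu A) /\
        (forall eps : R, 0 < eps ->
          exists gamma : R, 0 < gamma < gamma0 /\ delta gamma < eps);
    forall xi : R, 0 < xi < 1 ->
      exists eta : R, 0 < eta < 1 /\
        forall A S : set T, trapezoids e omega beta A -> S `<=` A ->
          mass mu S <= xi * mass mu A -> wmass mu w S <= eta * wmass mu w A].
Proof.
have mu0 : forall x, 0 < mu x by case: mu_flow.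
have [d d01 dmu] := parent_doubling T_tree omega_boundary mu0 mu_doubling.
have d0 : 0 < d by case/andP: d01.
have flow := flow_parent T_tree omega_boundary mu_flow d0 dmu.
have injf x m n : iter m (parent omega) x = iter n (parent omega) x -> m = n.
  exact: iter_parent_inj T_tree omega_boundary.
have finD n A := @ranked_trapezoids_finite _ _ _ mu beta n A mu0 injf flow.
have finF A : trapezoids e omega beta A -> finite_set A /\ A !=set0.
  by move=> /(trapezoidsE _ _ T_tree omega_boundary)[n]; exact: finD.
tfae.
- move=> [p [p1 /ereal_sup_image_lty[C ApC]]]; apply/ereal_sup_image_lty.
  by exists C; exact: Ainfty_const_of_Ap p1 finF ApC.
- move=> /ereal_sup_image_lty[C CP].
  (* The maximum with 2 makes L positive even if the constant C is not
     above 1. *)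
  pose L := ln (Num.max C 2).
  have M0 : 0 < Num.max C 2 by rewrite lt_max ltr0n orbT.
  have L0 : 0 < L by rewrite ln_gt0// lt_max ltr1n orbT.
  have CL A : trapezoids e omega beta A ->
      avg mu w A * expR (avg mu (fun y => ln (w y)^-1) A) <= expR L.
    by move=> /CP/le_trans; apply; rewrite lnK ?posrE// le_max lexx.
  pose gamma0 := expR (- (1 + L)).
  have lng gamma : 0 < gamma < gamma0 -> 1 + L < - ln gamma.
    move=> /andP[g0 gg]; rewrite ltrNr -ltr_expR.
    by rewrite lnK ?posrE.
  exists gamma0; split; first by rewrite expR_gt0 expR_lt1; lra.
  exists (fun gamma => L / (- ln gamma - 1)); split=> [gamma gg|eps eps0].
    have Lg := lng gamma gg; split.
      by rewrite divr_gt0//= ?ltr_pdivrMr; lra.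
    apply: (small_values_of_Ainfty_const mu0 w_gt0 finF CL); last by lra.
    by case/andP: gg.
  (* For this gamma, delta (gamma) = L / (1 + L + L / eps) < eps. *)
  exists (expR (- (2 + L + L / eps))).
  have Le0 : 0 < L / eps by exact: divr_gt0.
  rewrite expR_gt0 ltr_expR expRK opprK; split; first by lra.
  rewrite ltr_pdivrMr; last by lra.
  have -> : eps * (2 + L + L / eps - 1) = eps * (1 + L) + L.
    by field; rewrite gt_eqF.
  by rewrite ltrDr mulr_gt0//; lra.
- move=> [gamma0 [g01 [delta [small deps]]]] xi /andP[xi0 xi1].
  have [|gamma [gg dg]] := deps ((1 - xi) / 2); first by lra.
  have [/andP[dg0 dg1] smallg] := small gamma gg.
  have /andP[g0 g1] : 0 < gamma < 1 by lra.
  exists (1 - gamma * ((1 - xi) / 2)); split; first by apply/andP; split; nra.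
  move=> A S FA; have [finA A0] := finF A FA.
  apply: (wmass_le_of_small_values mu0 w_gt0 finA A0 g0 _ (smallg A FA)).
  rewrite opprB addrCA subrr addr0 mulrAC mulfV ?gt_eqF// mul1r; lra.
- move=> wD.
  have c01 : 0 < d ^+ 2 / beta < 1.
    have /andP[_ d1] := d01; rewrite divr_gt0 ?exprn_gt0//=; last by lra.
    by rewrite ltr_pdivrMr; nra.
  have splitD := splitting_trapezoids beta_ge12 d01 mu0 injf flow dmu.
  have [|p [C [p1 pC]]] := Ap_of_wmass_control mu0 w_gt0 c01 splitD finD.
    move=> xi /wD[eta [eta01 etaP]]; exists eta; split=> // m A S DA.
    by apply: etaP; apply/(trapezoidsE _ _ T_tree omega_boundary); exists m.
  exists p; split=> //; apply/ereal_sup_image_lty; exists C => A.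
  by move=> /(trapezoidsE _ _ T_tree omega_boundary)[m]; exact: pC.
Qed.
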